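(* Let $(R,\mathfrak{m})$ be a complete Noetherian local domain and let $A$ be a local domain containing $R$, equipped with a normalized valuation $v:A\to\mathbb{R}\cup\{\infty\}$, such that $A$ is an almost Cohen-Macaulay $R$-algebra with respect to $v$. Then the dagger closure on finitely generated $R$-modules defined by $(A,v)$ satisfies the Algebra Axiom: for every finitely generated $R$-module $M$ and every injective $R$-linear map $\alpha:R\to M$, if $\alpha$ is dag-phantom, then the $R$-linear map $\alpha':R\to\operatorname{Sym}^2_R(M)$ with $\alpha'(1)=\alpha(1)\otimes\alpha(1)$ is also dag-phantom.
   Context: All rings are commutative with identity. The local domain $A$ is not assumed to be Noetherian; ''$A$ contains $R$'' means that $R$ is a subring of $A$. Normalized valuation (also called normalized value map): a map $v:A\to\mathbb{R}\cup\{\infty\}$ such that for all $a,b\in A$: $v(ab)=v(a)+v(b)$; $v(a+b)\ge\min\{v(a),v(b)\}$; $v(a)=\infty$ if and only if $a=0$; $v(a)\ge 0$ for every $a\in A$; and $v(a)>0$ for every non-unit $a\in A$. Almost Cohen-Macaulay: $A$ is almost Cohen-Macaulay (with respect to $v$) if for every system of parameters $x_1,\ldots,x_d$ of $R$ (where $d=\dim R$), each element of $((x_1,\ldots,x_{i-1})A:_A x_i)/(x_1,\ldots,x_{i-1})A$, for each $1\le i\le d$, is annihilated by elements of sufficiently small order; that is, for each such element $\eta$ and every real $\epsilon>0$ there is $a\in A$ with $v(a)<\epsilon$ and $a\eta=0$. Dagger closure: for an $A$-module $L$ and a submodule $K\subseteq L$, let $K^v_L$ be the set of $x\in L$ such that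 for every real $\epsilon>0$ there exists $a\in A$ with $v(a)<\epsilon$ and $ax\in K$. For a finitely generated $R$-module $M$ and a submodule $N\subseteq M$, the dagger closure of $N$ in $M$ is $N^{\mathbf v}_M=\{x\in M: 1\otimes x\in K^v_{A\otimes_R M}\}$, where $K=\operatorname{im}(A\otimes_R N\to A\otimes_R M)$. Dag-phantom: let $M$ be a finitely generated $R$-module and $\alpha:R\to M$ an injective $R$-linear map with cokernel $Q$. Let $P_\bullet$ be a projective (equivalently free, $R$ being local) resolution of $Q$ by finitely generated modules, with differential $d:P_1\to P_0$. Lifting $\operatorname{id}_Q$ to a map from $\cdots\to P_2\to P_1\to P_0\to Q\to 0$ to $0\to R\xrightarrow{\alpha} M\to Q\to 0$ gives a map $\phi:P_1\to R$, a cocycle in $\operatorname{Hom}_R(P_1,R)$ representing the class in $\operatorname{Ext}^1_R(Q,R)$ of this short exact sequence. The map $\alpha$ is dag-phantom if $\phi\in B^{\mathbf v}_{\operatorname{Hom}_R(P_1,R)}$, where $B=\operatorname{im}(\operatorname{Hom}_R(P_0,R)\to\operatorname{Hom}_R(P_1,R))$ is the module of coboundaries. Being dag-phantom includes being injective. $\operatorname{Sym}^2_R(M)$ is the second symmetric power of $M$, i.e. the quotient of $M\otimes_R M$ by the submodule generated by all $m\otimes m'-m'\otimes m$; the image of $m\otimes m'$ is still written $m\otimes m'$. *)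

(* Defs.v *)
From HB Require Import structures.
From mathcomp Require Import all_boot all_order all_algebra.
From mathcomp Require Import finmap all_classical reals constructive_ereal.
(* The notations of monalg clash with those of constructive_ereal. *)
From mathcomp Require Import -(notations) monalg.

Set Implicit Arguments.
Unset Strict Implicit.
Unset Printing Implicit Defensive.

Import Order.TTheory GRing.Theory Num.Theory.

Local Open Scope classical_set_scope.
Local Open Scope ring_scope.

Section Submodules.
Variables (R : comNzRingType) (V : lmodType R).

Definition submodule (N : set V) : Prop :=
  N 0 /\ forall (a : R) (x y : V), N x -> N y -> N (a *: x + y).

Definition span (S : set V) : set V :=
  [set x | forall N : set V, submodule N -> S `<=` N -> N x].

Lemma span_submodule (S : set V) : submodule (span S).
Proof.
split=> [N [N0 _] _ //|a x y Sx Sy N hN SN].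
by apply: hN.2; [apply: Sx|apply: Sy].
Qed.

Lemma sub_span (S : set V) : S `<=` span S.
Proof. by move=> x Sx N _; apply. Qed.

Definition finitely_generated : Prop :=
  exists s : seq V, forall x : V, span [set` s] x.

Definition span_pred (S : set V) : {pred V} := fun x => `[< span S x >].

Lemma span_predE (S : set V) (x : V) : (x \in span_pred S) = `[< span S x >].
Proof. by []. Qed.

Lemma span_pred_closed (S : set V) : submod_closed (span_pred S).
Proof.
have [S0 SD] := span_submodule S.
split=> [|a x y]; rewrite !span_predE; first exact/asboolP.
by move=> /asboolP Sx /asboolP Sy; apply/asboolP; exact: SD.
Qed.

HB.instance Definition _ (S : set V) :=
  GRing.isSubmodClosed.Build R V (span_pred S) (span_pred_closed S).

(* The submodule generated by S as a module; it is S itself when S is a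
   submodule. *)
Definition submod (S : set V) : Type := {x : V | x \in span_pred S}.

HB.instance Definition _ (S : set V) := SubChoice.on (submod S).
HB.instance Definition _ (S : set V) :=
  [SubChoice_isSubLmodule of submod S by <:].

Definition submod_val (S : set V) : {linear submod S -> V} := val.

(* The quotient of V by the submodule generated by S. *)
Definition quotmod (S : set V) : Type := Quotient.quot (span_pred S).

HB.instance Definition _ (S : set V) := GRing.Zmodule.on (quotmod S).

Section QuotientModule.
Variable S : set V.

Definition quot_pi (x : V) : quotmod S := (\pi x)%qT.

Lemma quot_piP (x y : V) : quot_pi x = quot_pi y <-> span S (x - y).
Proof.
have E := Quotient.idealrBE (span_pred S) x y.
split=> [h|h]; last by apply/eqP; rewrite -E; apply/asboolP.
by apply/asboolP; move: E; rewrite span_predE => ->; apply/eqP.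
Qed.

Lemma quot_piK (q : quotmod S) : quot_pi (repr q) = q.
Proof. exact: reprK. Qed.

Lemma quot_piD : {morph quot_pi : x y / x + y}.
Proof. by move=> x y; rewrite /quot_pi !piE. Qed.

Definition quot_scale (a : R) (q : quotmod S) : quotmod S :=
  quot_pi (a *: repr q).

Lemma quot_piZ (a : R) (x : V) : quot_scale a (quot_pi x) = quot_pi (a *: x).
Proof.
apply/quot_piP; rewrite -scalerBr -[_ *: _]addr0.
have [S0 SD] := span_submodule S.
by apply: SD => //; apply/quot_piP; rewrite quot_piK.
Qed.

Lemma quot_scaleA (a b : R) (q : quotmod S) :
  quot_scale a (quot_scale b q) = quot_scale (a * b) q.
Proof. by rewrite -[q]quot_piK !quot_piZ scalerA. Qed.

Lemma quot_scale1 : left_id 1 quot_scale.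
Proof. by move=> q; rewrite -[q]quot_piK quot_piZ scale1r. Qed.

Lemma quot_scaleDr : right_distributive quot_scale +%R.
Proof.
move=> a p q; rewrite -[p]quot_piK -[q]quot_piK -quot_piD !quot_piZ.
by rewrite scalerDr quot_piD.
Qed.

Lemma quot_scaleDl (q : quotmod S) : {morph quot_scale^~ q : a b / a + b}.
Proof.
by move=> a b /=; rewrite -[q]quot_piK !quot_piZ scalerDl quot_piD.
Qed.

HB.instance Definition _ := GRing.Zmodule_isLmodule.Build R (quotmod S)
  quot_scaleA quot_scale1 quot_scaleDr quot_scaleDl.

Lemma quot_pi_linear : linear quot_pi.
Proof. by move=> a x y; rewrite quot_piD -quot_piZ. Qed.

HB.instance Definition _ :=
  GRing.isLinear.Build R V (quotmod S) *:%R quot_pi quot_pi_linear.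

Section Lift.
Variables (W : lmodType R) (f : {linear V -> W}).
Hypothesis f0 : forall x, S x -> f x = 0.

Definition quot_lift (q : quotmod S) : W := f (repr q).

Lemma quot_liftE (x : V) : quot_lift (quot_pi x) = f x.
Proof.
apply/eqP; rewrite -subr_eq0 -raddfB; apply/eqP.
have /quot_piP : quot_pi (repr (quot_pi x)) = quot_pi x by rewrite quot_piK.
move=> /(_ [set y | f y = 0]); apply; last by move=> y /f0.
split=> [|a y z /= fy fz]; first exact: raddf0.
by rewrite linearP fy fz scaler0 addr0.
Qed.

Lemma quot_lift_linear : linear quot_lift.
Proof.
move=> a p q; rewrite -[p]quot_piK -[q]quot_piK -linearP.
by rewrite !quot_liftE linearP.
Qed.

Definition quot_liftL : {linear quotmod S -> W} :=
  HB.pack quot_lift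
    (GRing.isLinear.Build R (quotmod S) W *:%R quot_lift quot_lift_linear).

End Lift.
End QuotientModule.
End Submodules.

Arguments finitely_generated {R} V.
Arguments quot_pi {R V} S x.

(* malg K R is the free R-module on K. *)
Definition gen (R : nzRingType) (K : choiceType) (k : K) : malg K R :=
  mkmalgU k 1.
Arguments gen {R K} k.

Section MalgLift.
Variables (R : comNzRingType) (K : choiceType) (W : lmodType R) (h : K -> W).

Definition malg_lift (g : malg K R) : W :=
  \sum_(k <- msupp g) mcoeff k g *: h k.

Lemma malg_liftEw (g : malg K R) (D : {fset K}) :
  (msupp g `<=` D)%fset -> malg_lift g = \sum_(k <- D) mcoeff k g *: h k.
Proof.
move=> sgD; apply: big_fset_incl => // k _ /mcoeff_outdom ->.
by rewrite scale0r.
Qed.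

Lemma malg_lift_linear : linear malg_lift.
Proof.
move=> a f g; pose D := (msupp f `|` msupp g)%fset.
have sD : (msupp (a *: f + g) `<=` D)%fset.
  by apply: fsubset_trans (msuppD_le _ _) (fsetSU _ (msuppZ_le _ _)).
rewrite (malg_liftEw sD) (malg_liftEw (fsubsetUl _ _ : msupp f `<=` D)%fset).
rewrite (malg_liftEw (fsubsetUr _ _ : msupp g `<=` D)%fset).
rewrite scaler_sumr -big_split /=; apply: eq_bigr => k _.
by rewrite mcoeffD mcoeffZ scalerDl scalerA.
Qed.

HB.instance Definition _ := GRing.isLinear.Build R (malg K R) W *:%R
  malg_lift malg_lift_linear.

Lemma malg_liftU (k : K) : malg_lift (gen k) = h k.
Proof.
by rewrite (malg_liftEw msuppU_le) big_seq_fset1 mcoeffUU scale1r.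
Qed.

End MalgLift.

(* For a ring map f : R -> B, a B-module X and an R-module N, the B-module
   X (x)_R N: the free B-module on X * N modulo the usual relations. It is
   used with f the embedding of R in A and X = A, and with f = id. *)
Section Tensor.
Variables (R B : comNzRingType) (f : {rmorphism R -> B}).
Variable X : lmodType B.

Section Def.
Variable N : lmodType R.

Variant tensor_rel : set (malg (X * N)%type B) :=
| TensorDl (x x' : X) (n : N) :
    tensor_rel (gen (x + x', n) - (gen (x, n) + gen (x', n)))
| TensorDr (x : X) (n n' : N) :
    tensor_rel (gen (x, n + n') - (gen (x, n) + gen (x, n')))
| TensorZl (b : B) (x : X) (n : N) :
    tensor_rel (gen (b *: x, n) - b *: gen (x, n))
| TensorZr (r : R) (x : X) (n : N) :
    tensor_rel (gen (f r *: x, n) - gen (x, r *: n)).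

Definition tensor : lmodType B := quotmod tensor_rel.

Definition tmul (x : X) (n : N) : tensor := quot_pi tensor_rel (gen (x, n)).

Lemma tmulDl (x x' : X) (n : N) : tmul (x + x') n = tmul x n + tmul x' n.
Proof.
rewrite /tmul -raddfD.
by apply/quot_piP; apply: sub_span; exact: TensorDl.
Qed.

Lemma tmulDr (x : X) (n n' : N) : tmul x (n + n') = tmul x n + tmul x n'.
Proof.
rewrite /tmul -raddfD.
by apply/quot_piP; apply: sub_span; exact: TensorDr.
Qed.

Lemma tmulZl (b : B) (x : X) (n : N) : tmul (b *: x) n = b *: tmul x n.
Proof.
rewrite /tmul -linearZ.
by apply/quot_piP; apply: sub_span; exact: TensorZl.
Qed.

Lemma tmulZr (r : R) (x : X) (n : N) : tmul x (r *: n) = f r *: tmul x n.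
Proof.
rewrite -tmulZl.
by apply/esym/quot_piP; apply: sub_span; exact: TensorZr.
Qed.

End Def.

Section Map.
Variables (N N' : lmodType R) (g : {linear N -> N'}).

Definition tensor_map_free : {linear malg (X * N)%type B -> tensor N'} :=
  malg_lift (fun p : X * N => tmul p.1 (g p.2)).

Lemma tensor_map_rel (z : malg (X * N)%type B) :
  tensor_rel z -> tensor_map_free z = 0.
Proof.
have E p : tensor_map_free (gen p) = tmul p.1 (g p.2) by apply: malg_liftU.
case=> *; rewrite linearB ?linearD ?linearZ !E /= ?linearD ?linearZ /=.
- by rewrite tmulDl -opprD subrr.
- by rewrite tmulDr -opprD subrr.
- by rewrite tmulZl scalerN subrr.
- by rewrite tmulZr tmulZl subrr.
Qed.

Definition tensor_map : {linear tensor N -> tensor N'} :=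
  quot_liftL tensor_map_rel.

Lemma tensor_mapE (x : X) (n : N) : tensor_map (tmul x n) = tmul x (g n).
Proof. by rewrite [LHS](quot_liftE tensor_map_rel) [LHS]malg_liftU. Qed.

End Map.
End Tensor.

Arguments tmul {R B} f {X N} x n.
Arguments tensor_map {R B} f X {N N'} g.

Section Sym2.
Variables (R : comNzRingType) (M : lmodType R).

Definition tensor2 : lmodType R := tensor (idfun : {rmorphism R -> R}) M M.

Definition sym2_rel : set tensor2 :=
  [set z | exists m m' : M, z = tmul idfun m m' - tmul idfun m' m].

Definition sym2 : lmodType R := quotmod sym2_rel.

Definition sym2_mul (m m' : M) : sym2 := quot_pi sym2_rel (tmul idfun m m').

End Sym2.

Section Hom.
Variables (R : comNzRingType) (U V : lmodType R).

Definition hom : Type := {linear U -> V}.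

Definition hom_fun (f : hom) : U -> V := (f : {linear U -> V}).

Lemma homP (f g : hom) : hom_fun f =1 hom_fun g -> f = g.
Proof.
case: f => f cf; case: g => g cg fg.
have {fg} E : f = g by apply/funext.
subst g; congr GRing.Linear.Pack.
case: cf cg => [[f0D] [fZ]] [[g0D] [gZ]].
by rewrite (Prop_irrelevance f0D g0D) (Prop_irrelevance fZ gZ).
Qed.

HB.instance Definition _ := gen_eqMixin hom.
HB.instance Definition _ := gen_choiceMixin hom.

Let hom0 : hom := (\0 : {linear U -> V}).
Let homN (f : hom) : hom := (\- (f : {linear U -> V}) : {linear U -> V}).
Let homD (f g : hom) : hom :=
  ((f : {linear U -> V}) \+ (g : {linear U -> V}) : {linear U -> V}).
Let homZ (a : R) (f : hom) : hom :=
  (a \*: (f : {linear U -> V}) : {linear U -> V}).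

Let homDA : associative homD.
Proof. by move=> f g h; apply: homP => x; exact: addrA. Qed.
Let homDC : commutative homD.
Proof. by move=> f g; apply: homP => x; exact: addrC. Qed.
Let hom0D : left_id hom0 homD.
Proof. by move=> f; apply: homP => x; exact: add0r. Qed.
Let homND : left_inverse hom0 homN homD.
Proof. by move=> f; apply: homP => x; exact: addNr. Qed.

HB.instance Definition _ := GRing.isZmodule.Build hom homDA homDC hom0D homND.

Let homZA (a b : R) (f : hom) : homZ a (homZ b f) = homZ (a * b) f.
Proof. by apply: homP => x; exact: scalerA. Qed.
Let homZ1 : left_id 1 homZ.
Proof. by move=> f; apply: homP => x; exact: scale1r. Qed.
Let homZDr : right_distributive homZ +%R.
Proof. by move=> a f g; apply: homP => x; exact: scalerDr. Qed.
Let homZDl (f : hom) : {morph homZ^~ f : a b / a + b}.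
Proof. by move=> a b; apply: homP => x; exact: scalerDl. Qed.

HB.instance Definition _ :=
  GRing.Zmodule_isLmodule.Build R hom homZA homZ1 homZDr homZDl.

End Hom.

Section ScalarMap.
Variables (R : comNzRingType) (V : lmodType R) (x : V).

Definition scalar_map (r : R^o) : V := (r : R) *: x.

Lemma scalar_map_linear : linear scalar_map.
Proof. by move=> a r s; rewrite /scalar_map scalerDl -scalerA. Qed.

HB.instance Definition _ :=
  GRing.isLinear.Build R R^o V *:%R scalar_map scalar_map_linear.

End ScalarMap.

Section Resolutions.
Variable R : comNzRingType.

Definition projective (P : lmodType R) : Prop :=
  forall (X Y : lmodType R) (g : {linear X -> Y}) (h : {linear P -> Y}),
    (forall y, exists x, g x = y) ->
    exists k : {linear P -> X}, forall p, g (k p) = h p.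

Record fg_projective_resolution (Q : lmodType R) := FgProjectiveResolution {
  res_mod :> nat -> lmodType R;
  res_diff : forall i, {linear res_mod i.+1 -> res_mod i};
  res_aug : {linear res_mod 0 -> Q};
  res_projective : forall i, projective (res_mod i);
  res_fg : forall i, finitely_generated (res_mod i);
  res_aug_surj : forall q, exists x, res_aug x = q;
  res_exact0 : forall x, res_aug x = 0 <-> exists y, res_diff 0 y = x;
  res_exact : forall i x,
    res_diff i x = 0 <-> exists y, res_diff i.+1 y = x
}.

End Resolutions.

Section Rings.
Variable R : comNzRingType.

Definition is_ideal (I : set R) : Prop := @submodule R R^o I.
Definition ideal_gen (S : set R) : set R := @span R R^o S.

Definition noetherian : Prop :=
  forall I : set R, is_ideal I -> exists s : seq R, I = ideal_gen [set` s].

Definition is_maximal (I : set R) : Prop :=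
  [/\ is_ideal I, ~ I 1 &
      forall J, is_ideal J -> I `<=` J -> ~ J 1 -> J = I].

Definition local_with (m : set R) : Prop :=
  is_maximal m /\ forall J, is_maximal J -> J = m.

Definition ideal_pow (I : set R) (n : nat) : set R :=
  ideal_gen [set x | exists2 t : 'I_n -> R,
                       forall i, I (t i) & x = \prod_(i < n) t i].

(* Complete and separated for the I-adic topology. *)
Definition adic_complete (I : set R) : Prop :=
  (forall x, (forall n, ideal_pow I n x) -> x = 0) /\
  (forall u : nat -> R,
     (forall k, exists N, forall i j, (N <= i)%N -> (N <= j)%N ->
        ideal_pow I k (u i - u j)) ->
     exists l, forall k, exists N, forall i, (N <= i)%N ->
        ideal_pow I k (u i - l)).

Definition is_prime (I : set R) : Prop :=
  [/\ is_ideal I, ~ I 1 & forall x y, I (x * y) -> I x \/ I y].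

Definition prime_chain (n : nat) : Prop :=
  exists p : nat -> set R,
    (forall i, (i <= n)%N -> is_prime (p i)) /\
    (forall i, (i < n)%N -> p i `<` p i.+1).

Definition krull_dim (d : nat) : Prop :=
  prime_chain d /\ forall n, prime_chain n -> (n <= d)%N.

(* For R local with maximal ideal m: d = dim R elements generating an
   m-primary ideal, i.e. an ideal with radical m. *)
Definition system_of_parameters (m : set R) (d : nat) (x : 'I_d -> R) : Prop :=
  krull_dim d /\
  forall y, m y <-> exists n, ideal_gen (range x) (y ^+ n).

End Rings.

Arguments noetherian R : clear implicits.

(* The values lie in [0, +oo] by the fourth condition, so the value -oo of the
   extended reals does not occur. *)
Definition normalized_valuation (K : realType) (A : idomainType)
    (v : A -> \bar K) : Prop :=
  [/\ forall a b, v (a * b) = (v a + v b)%E,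
      forall a b, (Order.min (v a) (v b) <= v (a + b)%R)%E,
      forall a, v a = +oo%E <-> a = 0,
      forall a, (0 <= v a)%E
    & forall a, a \isn't a GRing.unit -> (0 < v a)%E].

Section Dagger.
Variables (K : realType) (R A : idomainType).
Variables (iota : {rmorphism R -> A}) (v : A -> \bar K).

Definition almost_cohen_macaulay (m : set R) : Prop :=
  forall (d : nat) (x : 'I_d -> R), system_of_parameters m x ->
  forall i : 'I_d,
    let J := ideal_gen [set iota (x j) | j in [set j : 'I_d | (j < i)%N]] in
    forall eta : A, J (eta * iota (x i)) ->
    forall eps : K, 0 < eps -> exists2 a : A, (v a < eps%:E)%E & J (a * eta).

Definition vclosure (L : lmodType A) (N : set L) : set L :=
  [set x | forall eps : K, 0 < eps ->
             exists2 a : A, (v a < eps%:E)%E & N (a *: x)].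

(* N is meant to be a submodule of M; submod_val N is then its inclusion in M,
   and the set below is the closure of im (A (x) N -> A (x) M). *)
Definition dagger_closure (M : lmodType R) (N : set M) : set M :=
  [set x | vclosure (range (tensor_map iota A^o (submod_val N)))
                    (tmul iota (1 : A^o) x)].

Definition coboundaries (P0 P1 : lmodType R) (d : {linear P1 -> P0}) :
    set (hom P1 R^o) :=
  range (fun psi : hom P0 R^o =>
           ((psi : {linear P0 -> R^o}) \o d : {linear P1 -> R^o}) : hom P1 R^o).

(* theta and phi are the components in degrees 0 and 1 of a lifting of the
   identity of Q = coker alpha to a map from the augmented resolution to the
   complex 0 -> R -> M -> Q -> 0; whether phi lies in the closure of the
   coboundaries does not depend on the resolution or on the lifting. *)
Definition dag_phantom (M : lmodType R) (alpha : {linear R^o -> M}) : Prop :=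
  injective alpha /\
  exists (P : fg_projective_resolution (quotmod (range alpha)))
         (theta : {linear P 0 -> M}) (phi : {linear P 1 -> R^o}),
    [/\ forall x, quot_pi (range alpha) (theta x) = res_aug P x,
        forall x, alpha (phi x) = theta (res_diff P 0 x),
        forall x, phi (res_diff P 1 x) = 0
      & dagger_closure (coboundaries (res_diff P 0)) (phi : hom (P 1) R^o)].

End Dagger.

(* Main.v *)
(** Let Q be the cokernel of alpha, P_1 -> P_0 -> Q the start of a resolution
    by finite free modules and B the module of coboundaries in Hom(P_1, R).
    Since P_1 is finite free, A (x) Hom(P_1, R) is the module of R-linear maps
    P_1 -> A, so a.phi lies in the image of A (x) B exactly when
    a.phi : P_1 -> A factors through the differential P_1 -> P_0. As M is the
    pushout of R and P_0 along phi and the differential, such a factorization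
    is the same as an R-linear map g : M -> A with g(alpha(1)) = a. Hence alpha
    is dag-phantom iff there are R-linear maps g : M -> A with g(alpha(1)) of
    arbitrarily small order. For such a g, the R-linear map Sym^2(M) -> A given
    by x (x) y |-> g(x) g(y) sends alpha(1) (x) alpha(1) to an element of order
    2 v(g(alpha(1))). *)
From HB Require Import structures.
From mathcomp Require Import all_boot all_order all_algebra.
From mathcomp Require Import all_classical reals constructive_ereal.
From mathcomp Require Import -(notations) monalg.
Require Import Defs.

Set Implicit Arguments.
Unset Strict Implicit.
Unset Printing Implicit Defensive.

Import Order.TTheory GRing.Theory Num.Theory.

(** * Submodules, finite generation and the free modules ['rV[R]_n] *)

Section FiniteGeneration.
Local Open Scope classical_set_scope.
Local Open Scope ring_scope.
Variable R : comNzRingType.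

Lemma span_id (V : lmodType R) (S : set V) :
  submodule S -> span S `<=` S.
Proof. by move=> Ssub x; apply. Qed.

Lemma submoduleD (V : lmodType R) (S : set V) x y :
  submodule S -> S x -> S y -> S (x + y).
Proof. by move=> [_ SD] Sx Sy; rewrite -[x]scale1r; exact: SD. Qed.

Lemma submoduleZ (V : lmodType R) (S : set V) a x :
  submodule S -> S x -> S (a *: x).
Proof. by move=> [S0 SD] Sx; rewrite -[_ *: _]addr0; exact: SD. Qed.

Lemma submodule_sum (V : lmodType R) (S : set V) (I : Type) (r : seq I)
    (F : I -> V) :
  submodule S -> (forall i, S (F i)) -> S (\sum_(i <- r) F i).
Proof.
move=> Ssub SF; elim/big_ind: _ => //; first by case: Ssub.
by move=> x y; exact: submoduleD.
Qed.

Lemma submodule_preimage (V W : lmodType R) (f : {linear V -> W}) (S : set W) :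
  submodule S -> submodule (f @^-1` S).
Proof.
move=> [S0 SD]; split=> [|a x y] /=; first by rewrite linear0.
by move=> Sx Sy; rewrite linearP; exact: SD.
Qed.

Lemma submodule_range (V W : lmodType R) (f : {linear V -> W}) :
  submodule (range f).
Proof.
split=> [|a _ _ [x _ <-] [y _ <-]]; first by exists 0; rewrite ?linear0.
by exists (a *: x + y); rewrite ?linearP.
Qed.

Lemma submodule_ker (V W : lmodType R) (f : {linear V -> W}) :
  submodule [set x | f x = 0].
Proof.
split=> [|a x y /= fx fy]; first by rewrite /= linear0.
by rewrite linearP fx fy scaler0 addr0.
Qed.

Lemma quot_pi_eq0 (V : lmodType R) (S : set V) x :
  submodule S -> quot_pi S x = 0 <-> S x.
Proof.
move=> Ssub; rewrite -(linear0 (quot_pi S)) quot_piP subr0.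
by split=> [/(span_id Ssub)|/sub_span].
Qed.

Definition lincomb (V : lmodType R) n (e : 'I_n -> V) (c : 'rV[R]_n) : V :=
  \sum_i c 0 i *: e i.

Lemma lincomb_linear (V : lmodType R) n (e : 'I_n -> V) : linear (lincomb e).
Proof.
move=> a c c'; rewrite /lincomb scaler_sumr -big_split /=.
by apply: eq_bigr => i _; rewrite !mxE scalerDl scalerA.
Qed.

HB.instance Definition _ (V : lmodType R) n (e : 'I_n -> V) :=
  GRing.isLinear.Build R 'rV[R]_n V *:%R (lincomb e) (lincomb_linear e).

Lemma lincomb_delta (V : lmodType R) n (e : 'I_n -> V) i :
  lincomb e (delta_mx 0 i) = e i.
Proof.
rewrite /lincomb (bigD1 i) //= big1 ?addr0 ?mxE ?eqxx ?scale1r // => j ji.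
by rewrite mxE eqxx (negPf ji) scale0r.
Qed.

Lemma linear_rowE (V : lmodType R) n (f : {linear 'rV[R]_n -> V}) c :
  f c = lincomb (fun i => f (delta_mx 0 i)) c.
Proof.
rewrite [in LHS](row_sum_delta c) linear_sum.
by apply: eq_bigr => i _; rewrite linearZ.
Qed.

Lemma row_projective n : projective 'rV[R]_n.
Proof.
move=> X Y g h gsurj.
have /choice[e ge] : forall i, exists x, g x = h (delta_mx 0 i) by [].
exists (lincomb e) => p; rewrite [RHS]linear_rowE linear_sum.
by apply: eq_bigr => i _; rewrite linearZ ge.
Qed.

Lemma span_seqP (V : lmodType R) (s : seq V) x :
  span [set` s] x -> exists c, x = lincomb (fun i : 'I_(size s) => s`_i) c.
Proof.
pose f : {linear 'rV_(size s) -> V} := lincomb (fun i : 'I_(size s) => s`_i).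
move=> /(_ (range f) (submodule_range f)) [|c _ <-]; last by exists c.
move=> y /= ys; have lt_ys : (index y s < size s)%N by rewrite index_mem.
by exists (delta_mx 0 (Ordinal lt_ys)) => //; rewrite /f lincomb_delta /= nth_index.
Qed.

Lemma fg_surj (V W : lmodType R) (f : {linear V -> W}) :
  finitely_generated V -> (forall y, exists x, f x = y) ->
  finitely_generated W.
Proof.
move=> [s sV] fsurj; exists (map f s) => y; have [x <-] := fsurj y.
apply: (sV x (f @^-1` span [set` map f s])).
  exact/submodule_preimage/span_submodule.
by move=> z /= zs; apply: sub_span => /=; exact: map_f.
Qed.

Lemma fg_quotmod (V : lmodType R) (S : set V) :
  finitely_generated V -> finitely_generated (quotmod S).
Proof.
move=> V_fg; apply: (fg_surj (f := quot_pi S)) => // q.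
by exists (repr q); exact: quot_piK.
Qed.

Lemma fg_row n : finitely_generated 'rV[R]_n.
Proof.
exists [seq delta_mx 0 i | i <- enum 'I_n] => x; rewrite (row_sum_delta x).
apply: (submodule_sum (S := span _)) => [|i]; first exact: span_submodule.
apply: (submoduleZ (S := span _)); first exact: span_submodule.
by apply: sub_span => /=; apply: map_f; rewrite mem_enum.
Qed.

End FiniteGeneration.

(** * Induction principle and universal property of the tensor product *)

Section TensorLift.
Local Open Scope classical_set_scope.
Local Open Scope ring_scope.
Variables (R B : comNzRingType) (f : {rmorphism R -> B}).
Variables (X : lmodType B) (N : lmodType R).

(** A representative in the free module is a finite combination of generators, and [S] absorbs both
    sums and coefficients. *)
Lemma tensor_ind (S : set (tensor f X N)) :
  submodule S -> (forall x n, S (tmul f x n)) -> forall z, S z.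
Proof.
move=> Ssub ST z; rewrite -(quot_piK (z : quotmod _)) [repr _]monalgE linear_sum.
apply: submodule_sum => // -[x n].
have -> : mkmalgU (x, n) (mcoeff (x, n) (repr z)) =
    mcoeff (x, n) (repr z) *: gen (x, n) :> malg (X * N)%type B.
  by apply/malgP => k; rewrite mcoeffZ !mcoeffU mulrnAr mulr1.
by rewrite linearZ; apply: submoduleZ => //; exact: ST.
Qed.

Variables (W : lmodType B) (h : X -> N -> W).
Hypothesis hDl : forall x x' n, h (x + x') n = h x n + h x' n.
Hypothesis hDr : forall x n n', h x (n + n') = h x n + h x n'.
Hypothesis hZl : forall b x n, h (b *: x) n = b *: h x n.
Hypothesis hZr : forall r x n, h x (r *: n) = f r *: h x n.

Let lift_free : {linear malg (X * N)%type B -> W} :=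
  malg_lift (fun p : X * N => h p.1 p.2).

Lemma tensor_lift_rel z : @tensor_rel R B f X N z -> lift_free z = 0.
Proof.
have E p : lift_free (gen p) = h p.1 p.2 by apply: malg_liftU.
case=> *; rewrite linearB ?linearD ?linearZ !E /=.
- by rewrite hDl -opprD subrr.
- by rewrite hDr -opprD subrr.
- by rewrite hZl scalerN subrr.
- by rewrite hZr hZl subrr.
Qed.

Definition tensor_lift : {linear tensor f X N -> W} :=
  quot_liftL tensor_lift_rel.

Lemma tensor_liftE x n : tensor_lift (tmul f x n) = h x n.
Proof. by rewrite [LHS](quot_liftE tensor_lift_rel) [LHS]malg_liftU. Qed.

End TensorLift.

(** * Resolutions by finite free modules over a Noetherian ring *)

Section NoetherianResolutions.
Local Open Scope classical_set_scope.
Local Open Scope ring_scope.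
Variable R : comNzRingType.
Hypothesis R_noetherian : noetherian R.

(** Induction on [n], splitting off the first coordinate. The first coordinates of elements of [N]
    form an ideal [I], finitely generated as [R] is Noetherian; the elements with vanishing first
    coordinate form a submodule [N'] of rank one less. Lifts [w] of generators of [I], followed by
    generators of [N'], are the rows of the matrix. *)
Lemma submodule_row_fg n (N : set 'rV[R]_n) : submodule N ->
  exists l (B : 'M[R]_(l, n)), forall x, N x <-> exists y, y *m B = x.
Proof.
elim: n N => [|n IHn]; last rewrite -[n.+1]/(1 + n)%N; move=> N Nsub.
  exists 0%N, 0 => x; rewrite [x]thinmx0; split=> _; last by case: Nsub.
  by exists 0; rewrite mulmx0.
pose I : set R := [set r | exists2 x, N x & x 0 0 = r].
have [s Is] : exists s : seq R, I = ideal_gen [set` s].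
  apply: R_noetherian; split=> [|a _ _ [x Nx <-] [y Ny <-]].
    by exists 0; rewrite ?mxE //; case: Nsub.
  by exists (a *: x + y); rewrite ?mxE //; apply: Nsub.2.
have /choice[w wP] : forall i : 'I_(size s), exists x, N x /\ x 0 0 = s`_i.
  move=> i; have [x Nx x0] : I s`_i.
    by rewrite Is; apply: sub_span => /=; rewrite mem_nth.
  by exists x.
pose N' : set 'rV[R]_n := [set y | N (row_mx (0 : 'rV_1) y : 'rV_(1 + n))].
have N'sub : submodule N'.
  split=> [|a x y]; rewrite /N' /= ?row_mx0; first by case: Nsub.
  move=> Nx Ny; have -> : row_mx (0 : 'rV_1) (a *: x + y) =
      a *: row_mx (0 : 'rV_1) x + row_mx (0 : 'rV_1) y.
    by rewrite scale_row_mx add_row_mx scaler0 addr0.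
  exact: Nsub.2.
have [l [B BP]] := IHn N' N'sub.
pose W : 'M[R]_(size s, 1 + n) := \matrix_i w i.
have NW c : N (c *m W).
  rewrite mulmx_sum_row; apply: (submodule_sum (S := N)) => // i.
  by rewrite rowK; apply: (submoduleZ (S := N)) => //; case: (wP i).
exists (size s + l)%N, (col_mx W (row_mx 0 B) : 'M_(_, 1 + n)) => x.
split=> [Nx|[y <-]]; last first.
  rewrite -[y]hsubmxK mul_row_col; apply: (submoduleD (S := N)) => //.
  by rewrite mul_mx_row mulmx0; apply/BP; exists (rsubmx y).
have [c xc] : exists c, x 0 0 = lincomb (fun i : 'I_(size s) => s`_i : R^o) c.
  by apply: (@span_seqP R R^o s); have : I (x 0 0) by [exists x]; rewrite Is.
(* The combination [c *m W] has the same first coordinate as [x], so the difference comes from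
   [N']. *)
have lx0 : lsubmx (x - c *m W : 'rV_(1 + n)) = 0.
  apply/rowP => i; rewrite ord1 !mxE.
  have -> : lshift n 0 = 0 :> 'I_(1 + n) by apply/val_inj.
  rewrite xc /lincomb -sumrB big1 // => j _.
  by rewrite mxE; case: (wP j) => _ ->; rewrite subrr.
have /BP[z xz] : N' (rsubmx (x - c *m W : 'rV_(1 + n))).
  rewrite /N' /= -lx0 hsubmxK addrC -scaleN1r.
  by apply: Nsub.2.
exists (row_mx c z); rewrite mul_row_col mul_mx_row mulmx0 xz -lx0 hsubmxK.
by rewrite addrC subrK.
Qed.

Lemma fg_free_cover (Q : lmodType R) : finitely_generated Q ->
  exists n (e : 'I_n -> Q), forall q, exists c, lincomb e c = q.
Proof.
move=> [s sQ]; exists (size s), (fun i => s`_i) => q.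
by have [c] := span_seqP (sQ q); exists c.
Qed.

Lemma syzygies k n (D : 'M[R]_(k, n)) :
  exists s : {l & 'M[R]_(l, k)},
    forall x : 'rV_k, x *m D = 0 <-> exists y, y *m tagged s = x.
Proof.
have [l [B BP]] := submodule_row_fg (submodule_ker (mulmxr D)).
exists (Tagged (fun l => 'M[R]_(l, k)) B) => x; exact: iff_trans (BP x).
Qed.

(* Keeping the shape in the state makes the number of rows of one matrix
   convertible to the number of columns of the next. *)
Definition matrix_shape : Type := {k & {n & 'M[R]_(k, n)}}.

Definition next_syzygy (t : matrix_shape) : matrix_shape :=
  let s := sval (cid (syzygies (tagged (tagged t)))) in
  Tagged _ (Tagged (fun n => 'M[R]_(tag s, n)) (tagged s)).

Section Resolution.
Variables (Q : lmodType R) (n0 : nat) (e : 'I_n0 -> Q).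
Hypothesis e_gen : forall q, exists c, lincomb e c = q.
Variables (n1 : nat) (D : 'M[R]_(n1, n0)).
Hypothesis D_ker : forall x, lincomb e x = 0 <-> exists y, y *m D = x.

Definition res_matrix i : matrix_shape :=
  iter i next_syzygy (Tagged _ (Tagged (fun n => 'M[R]_(n1, n)) D)).

(** The [i]-th matrix is the differential from degree [i.+1] to degree [i], acting on row vectors
    from the right; its columns therefore count the rank in degree [i]. *)
Definition res_rank i : nat := tag (tagged (res_matrix i)).

Definition res_map i : {linear 'rV[R]_(res_rank i.+1) -> 'rV[R]_(res_rank i)} :=
  mulmxr (tagged (tagged (res_matrix i))).

Lemma res_map_exact i x : res_map i x = 0 <-> exists y, res_map i.+1 y = x.
Proof. exact: (svalP (cid (syzygies (tagged (tagged (res_matrix i)))))). Qed.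

Definition free_resolution : fg_projective_resolution Q :=
  @FgProjectiveResolution R Q (fun i => 'rV[R]_(res_rank i)) res_map
    (lincomb e) (fun i => @row_projective R _) (fun i => @fg_row R _)
    e_gen D_ker res_map_exact.

End Resolution.
End NoetherianResolutions.

(** * Finite generation of tensor products and of the symmetric square *)

Section TensorGeneration.
Local Open Scope classical_set_scope.
Local Open Scope ring_scope.
Variables (R B : comNzRingType) (f : {rmorphism R -> B}).
Variables (X : lmodType B) (N : lmodType R).

Lemma fg_tensor :
  finitely_generated X -> finitely_generated N ->
  finitely_generated (tensor f X N).
Proof.
move=> [s sX] [t tN]; pose u := [seq tmul f x n | x <- s, n <- t].
exists u; pose S := span [set` u].
have Ssub : submodule S by exact: span_submodule.
(* The two factors are reduced to generators in turn, each time by exhibiting a submodule that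
   contains them: first the [x] that work for every [n], then, for a generator [y] of [X], the [n]
   that work for [y]. *)
apply: (tensor_ind Ssub) => x n; move: x (sX x) n => x.
move=> /(_ [set x | forall n, S (tmul f x n)]); apply.
  split=> [n|a y z Sy Sz n].
    by rewrite -(scale0r (0 : X)) tmulZl scale0r; case: Ssub.
  by rewrite tmulDl tmulZl; apply: Ssub.2.
move=> y /= ys n; move: n (tN n) => n.
move=> /(_ [set n | S (tmul f y n)]); apply.
  split=> [|a p q Sp Sq] /=.
    by rewrite -(scale0r (0 : N)) tmulZr rmorph0 scale0r; case: Ssub.
  by rewrite tmulDr tmulZr; apply: Ssub.2.
by move=> p /= pt; apply: sub_span => /=; apply/allpairsP; exists (y, p).
Qed.

End TensorGeneration.

Lemma fg_sym2 (R : comNzRingType) (M : lmodType R) :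
  finitely_generated M -> finitely_generated (sym2 M).
Proof. by move=> M_fg; apply/fg_quotmod/fg_tensor. Qed.

Section LinearFactor.
Local Open Scope ring_scope.
Variables (R : comNzRingType) (U V W : lmodType R).
Variables (f : {linear V -> W}) (h : {linear V -> U}).

(** For a set-theoretic section [s] of [f], the map [h \o s] is linear because [h] takes equal
    values on points with the same image under [f]. *)
Lemma linear_factor :
  (forall y, exists x, f x = y) -> (forall x, f x = 0 -> h x = 0) ->
  exists g : {linear W -> U}, forall x, g (f x) = h x.
Proof.
move=> /choice[s sK] ker0.
have eq_h x y : f x = f y -> h x = h y.
  move=> fxy; apply/eqP; rewrite -subr_eq0 -linearB ker0 //.
  by rewrite linearB fxy subrr.
have lin : linear (h \o s).
  by move=> a x y /=; rewrite -linearP; apply: eq_h; rewrite linearP !sK.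
exists (HB.pack (h \o s) (GRing.isLinear.Build R W U *:%R (h \o s) lin)
  : {linear W -> U}) => x /=.
by apply: eq_h; rewrite sK.
Qed.

End LinearFactor.

(** * Restriction of scalars, and squares of functionals *)

Section RestrictionOfScalars.
Local Open Scope ring_scope.
Variables (R B : comNzRingType).

(* The ring B viewed as an R-module through f. *)
Definition restrict (f : {rmorphism R -> B}) : Type := B.

Variable f : {rmorphism R -> B}.

HB.instance Definition _ := GRing.Zmodule.on (restrict f).

Definition restrict_scale (r : R) (x : restrict f) : restrict f :=
  f r * (x : B).

Lemma restrict_scaleA r s x :
  restrict_scale r (restrict_scale s x) = restrict_scale (r * s) x.
Proof. by rewrite /restrict_scale rmorphM mulrA. Qed.

Lemma restrict_scale1 : left_id 1 restrict_scale.
Proof. by move=> x; rewrite /restrict_scale rmorph1 mul1r. Qed.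

Lemma restrict_scaleDr : right_distributive restrict_scale +%R.
Proof. by move=> r x y; exact: mulrDr. Qed.

Lemma restrict_scaleDl x : {morph restrict_scale^~ x : r s / r + s}.
Proof. by move=> r s; rewrite /restrict_scale rmorphD mulrDl. Qed.

HB.instance Definition _ := GRing.Zmodule_isLmodule.Build R (restrict f)
  restrict_scaleA restrict_scale1 restrict_scaleDr restrict_scaleDl.

Lemma restrict_scaleE (r : R) (x : restrict f) : r *: x = f r * (x : B) :> B.
Proof. by []. Qed.

Section Sym2Square.
Variables (M : lmodType R) (g : {linear M -> restrict f}).

Let mul (x y : M) : restrict f := (g x : B) * g y.

Let mulDl x x' y : mul (x + x') y = mul x y + mul x' y.
Proof. by rewrite /mul linearD; exact: mulrDl. Qed.

Let mulDr x y y' : mul x (y + y') = mul x y + mul x y'.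
Proof. by rewrite /mul linearD; exact: mulrDr. Qed.

Let mulZl r x y : mul (r *: x) y = r *: mul x y.
Proof. by rewrite /mul linearZ; exact/esym/mulrA. Qed.

Let mulZr r x y : mul x (r *: y) = r *: mul x y.
Proof. by rewrite /mul linearZ; exact: mulrCA. Qed.

Let tensor_square : {linear tensor2 M -> restrict f} :=
  tensor_lift (f := idfun) mulDl mulDr mulZl mulZr.

(** The product of [B] is commutative, so the bilinear map sending [x], [y] to [g x * g y] is
    symmetric and descends to [sym2 M]. *)
Lemma sym2_square :
  exists h : {linear sym2 M -> restrict f},
    forall x y, h (sym2_mul x y) = (g x : B) * g y.
Proof.
have sym0 z : sym2_rel z -> tensor_square z = 0.
  move=> [x [y ->]]; rewrite linearB !tensor_liftE /mul.
  by rewrite [(g x : B) * _]mulrC subrr.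
exists (quot_liftL sym0) => x y.
by rewrite [LHS](quot_liftE sym0) tensor_liftE.
Qed.

End Sym2Square.

(** * Evaluation of [B]-multiples of functionals on [P] *)

Section Evaluation.
Variable P : lmodType R.

Section EvaluationAt.
Variable p : P.

Let ev (b : B^o) (h : hom P R^o) : B^o := b * f (hom_fun h p).

Let evDl b b' h : ev (b + b') h = ev b h + ev b' h.
Proof. exact: mulrDl. Qed.

Let evDr b h h' : ev b (h + h') = ev b h + ev b h'.
Proof. by rewrite /ev -mulrDr -rmorphD. Qed.

Let evZl c b h : ev (c *: b) h = c *: ev b h.
Proof. exact/esym/mulrA. Qed.

Let evZr r b h : ev b (r *: h) = f r *: ev b h.
Proof. by rewrite /ev [RHS]mulrCA -rmorphM. Qed.

(** As [p] varies, this is the canonical map from the tensor product of [B] and [Hom_R(P, R)] to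
    [Hom_R(P, B)]. *)
Definition tensor_ev : {linear tensor f B^o (hom P R^o) -> B^o} :=
  tensor_lift evDl evDr evZl evZr.

Lemma tensor_evE b h : tensor_ev (tmul f b h) = b * f (hom_fun h p).
Proof. exact: tensor_liftE. Qed.

End EvaluationAt.

End Evaluation.

Section RowTensorHom.
Variable n : nat.

Definition row_coord (i : 'I_n) : hom 'rV[R]_n R^o :=
  (lincomb (fun j => (i == j)%:R : R^o) : {linear 'rV[R]_n -> R^o}).

Lemma row_coordE i x : hom_fun (row_coord i) x = x 0 i.
Proof.
rewrite /= /lincomb (bigD1 i) //= eqxx [_ *: _]mulr1 big1 ?addr0 // => j ji.
by rewrite eq_sym (negPf ji) [_ *: _]mulr0.
Qed.

(** Expansion in the dual basis. Both sides are linear in [w], so pure tensors suffice; there the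
    functional is expanded in the [row_coord i] and its coefficients are moved to the factor [B]. *)
Lemma tensor_hom_rowE (w : tensor f B^o (hom 'rV[R]_n R^o)) :
  w = \sum_i tmul f (tensor_ev (delta_mx 0 i) w : B^o) (row_coord i).
Proof.
pose T := tensor f B^o (hom 'rV[R]_n R^o).
pose h (w : T) : T :=
  \sum_i tmul f (tensor_ev (delta_mx 0 i) w : B^o) (row_coord i).
have h_lin : linear h.
  move=> c x y; rewrite /h scaler_sumr -big_split.
  by apply: eq_bigr => i _; rewrite linearP tmulDl tmulZl.
pose hL : {linear T -> T} := HB.pack h (GRing.isLinear.Build B T T *:%R h h_lin).
have tmul_sum b (F : 'I_n -> hom 'rV[R]_n R^o) :
    tmul f (b : B^o) (\sum_i F i) = \sum_i tmul f b (F i).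
  elim/big_rec2: _ => [|i y1 y2 _ <-]; last by rewrite tmulDr.
  by rewrite -(scale0r (0 : hom 'rV[R]_n R^o)) tmulZr rmorph0 scale0r.
apply: (tensor_ind (S := [set w : T | w = hL w])%classic) => [|b k].
  split=> [|c x y]; first exact/esym/(linear0 hL).
  by rewrite /mkset (linearP hL) => <- <-.
pose H : lmodType R := hom 'rV[R]_n R^o.
pose c i : R := hom_fun k (delta_mx 0 i).
have kE : k = \sum_i c i *: (row_coord i : H).
  apply: homP => x.
  have -> : hom_fun (\sum_i c i *: (row_coord i : H)) x =
      \sum_i c i * x 0 i.
    elim/big_rec2: _ => [//|i y1 y2 _ IH].
    by rewrite -IH -row_coordE.
  rewrite [LHS](linear_rowE (k : {linear 'rV[R]_n -> R^o})).
  by apply: eq_bigr => i _; exact: mulrC.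
rewrite /mkset [in LHS]kE tmul_sum; apply: eq_bigr => i _.
by rewrite tensor_evE tmulZr -tmulZl mulrC.
Qed.

(** Allows equalities in the tensor product to be tested by evaluation. *)
Lemma tensor_hom_row_inj (w w' : tensor f B^o (hom 'rV[R]_n R^o)) :
  (forall x, tensor_ev x w = tensor_ev x w') -> w = w'.
Proof.
move=> eqw; rewrite (tensor_hom_rowE w) (tensor_hom_rowE w').
by apply: eq_bigr => i _; rewrite eqw.
Qed.

End RowTensorHom.
End RestrictionOfScalars.

(** * Dag-phantom maps and functionals of small order on [M] *)

Section PhantomCriterion.
Local Open Scope classical_set_scope.
Local Open Scope ring_scope.
Variables (K : realType) (R A : idomainType).
Variables (iota : {rmorphism R -> A}) (v : A -> \bar K).

Lemma submodule_coboundaries (P0 P1 : lmodType R) (d : {linear P1 -> P0}) :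
  submodule (coboundaries d).
Proof.
split=> [|a _ _ [f _ <-] [g _ <-]]; first by exists 0 => //; exact: homP.
by exists (a *: f + g) => //; exact: homP.
Qed.

(** A pure tensor of [b] and [f \o d] evaluates to [b * iota (f (d x))], which factors through [d];
    the elements admitting such a [psi] form an [A]-submodule. *)
Lemma tensor_coboundary_ev (P0 P1 : lmodType R) (d : {linear P1 -> P0})
    (z : tensor iota A^o (submod (coboundaries d))) :
  exists psi : {linear P0 -> restrict iota}, forall x,
    tensor_ev iota x (tensor_map iota A^o (submod_val _) z) = psi (d x).
Proof.
pose T := tensor iota A^o (submod (coboundaries d)).
pose G x : {linear T -> A^o} :=
  tensor_ev iota x \o tensor_map iota A^o (submod_val (coboundaries d)).
pose S : set T := [set z | exists psi : {linear P0 -> restrict iota},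
  forall x, G x z = psi (d x)].
apply: (tensor_ind (S := S)) => [|b h].
  split=> [|a y z' [psi psiE] [psi' psi'E]].
    by exists \0 => x; exact: (linear0 (G x)).
  pose chi p : restrict iota := (a : A) * psi p + psi' p.
  have chi_lin : linear chi.
    move=> r p q; rewrite /chi !linearP !restrict_scaleE.
    rewrite !mulrDr (mulrCA (a : A)) -!addrA; congr (_ + _).
    by rewrite addrCA.
  exists (HB.pack chi (GRing.isLinear.Build R P0 (restrict iota) *:%R chi chi_lin)
    : {linear P0 -> restrict iota}) => x.
  by rewrite (linearP (G x)) psiE psi'E.
(* [submod] carries the span of the coboundaries, which is the set of coboundaries itself. *)
have [f _ fE] : coboundaries d (val h).
  by apply: (span_id (submodule_coboundaries d)); apply/asboolP; exact: (valP h).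
pose psi p : restrict iota := (b : A) * iota (hom_fun f p).
have psi_lin : linear psi.
  move=> r p q; rewrite /psi restrict_scaleE.
  rewrite [hom_fun f _](linearP (f : {linear P0 -> R^o})).
  by rewrite rmorphD mulrDr (rmorphM iota r) mulrCA.
exists (HB.pack psi (GRing.isLinear.Build R P0 (restrict iota) *:%R psi psi_lin)
  : {linear P0 -> restrict iota}) => x.
apply: etrans (congr1 (tensor_ev iota x) (tensor_mapE iota _ b h)) _.
by rewrite tensor_evE /= -fE.
Qed.

Variables (M : lmodType R) (alpha : {linear R^o -> M}).

(** The resolution is whichever one witnesses [dag_phantom]; its exactness at [Q] and at [P 0]
    exhibits [M] as a pushout. *)
Lemma dag_phantom_functional : dag_phantom iota v alpha ->
  forall eps : K, 0 < eps ->
  exists g : {linear M -> restrict iota}, (v (g (alpha 1%R)) < eps%:E)%E.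
Proof.
move=> [alpha_inj [P [theta [phi [theta_aug phi_theta _ phi_closure]]]]].
move=> eps /phi_closure[a va [z _ zE]].
have [psi psiE] := tensor_coboundary_ev z.
have psi_phi x : psi (res_diff P 0 x) = (a : A) * iota (phi x).
  by rewrite -psiE zE linearZ tensor_evE mul1r.
(* [f] presents [M] as a quotient of the direct sum of [R] and [P 0]; the functional [h] on this sum
   is to be pushed down to [M]. *)
pose f (x : (R^o * P 0)%type) : M := alpha x.1 + theta x.2.
pose h (x : (R^o * P 0)%type) : restrict iota :=
  (a : A) * iota x.1 + psi x.2.
have f_lin : linear f.
  move=> r x y; rewrite /f !linearP scalerDr -!addrA; congr (_ + _).
  by rewrite addrCA.
have h_lin : linear h.
  move=> r x y; rewrite /h /= linearP rmorphD (rmorphM iota r).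
  rewrite !restrict_scaleE !mulrDr (mulrCA (a : A)) -!addrA; congr (_ + _).
  by rewrite addrCA.
pose F : {linear (R^o * P 0)%type -> M} :=
  HB.pack f (GRing.isLinear.Build R _ M *:%R f f_lin).
pose H : {linear (R^o * P 0)%type -> restrict iota} :=
  HB.pack h (GRing.isLinear.Build R _ (restrict iota) *:%R h h_lin).
have range_sub := submodule_range alpha.
have [y||g gE] := @linear_factor R _ _ _ F H.
- have [p pE] := res_aug_surj P (quot_pi (range alpha) y).
  have [r _ rE] : range alpha (y - theta p).
    apply/(quot_pi_eq0 _ range_sub).
    by rewrite linearB /= -pE -theta_aug subrr.
  by exists (r, p); rewrite /= /f /= rE subrK.
(* If [alpha r + theta p = 0], then [p] dies in [Q] and is a boundary [d y]; injectivity of [alpha]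
   gives [phi y = - r], so [psi p] cancels [a * iota r]. *)
- move=> [r p] /= /eqP; rewrite /f /h /= addrC addr_eq0 => /eqP thetaE.
  have [y yE] : exists y, res_diff P 0 y = p.
    apply/res_exact0; rewrite -theta_aug thetaE linearN.
    apply/eqP; rewrite oppr_eq0; apply/eqP/(quot_pi_eq0 _ range_sub).
    by exists r.
  have phiE : phi y = - r by apply: alpha_inj; rewrite phi_theta yE thetaE linearN.
  by rewrite -yE psi_phi phiE rmorphN mulrN subrr.
(* Evaluating at [(1, 0)] gives [g (alpha 1) = a]. *)
exists g; rewrite -[alpha 1]addr0 -(linear0 theta).
by rewrite (gE (1, 0)) /= /h /= rmorph1 mulr1 linear0 addr0.
Qed.

Hypothesis R_noetherian : noetherian R.
Hypothesis iota_injective : injective iota.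
Hypothesis v0 : v 0 = +oo%E.
Hypothesis M_fg : finitely_generated M.

(** For the converse a resolution by finite free modules is built, so that membership in the image
    of the coboundaries becomes an identity between values, by [tensor_hom_row_inj]. *)
Lemma dag_phantomP : dag_phantom iota v alpha <->
  forall eps : K, 0 < eps ->
  exists g : {linear M -> restrict iota}, (v (g (alpha 1%R)) < eps%:E)%E.
Proof.
split=> [|small]; first exact: dag_phantom_functional.
have g_alpha (g : {linear M -> restrict iota}) r :
    g (alpha r) = iota r * (g (alpha 1) : A).
  by rewrite -restrict_scaleE -!linearZ [_ *: _]mulr1.
have alpha_inj : injective alpha.
  (* Any finite bound serves: it forces [g (alpha 1)] to be nonzero, and [g \o alpha] is then [iota]
     times a nonzero element of a domain. *)
  move=> r s rs; have [g gv] := small 1 ltr01.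
  have ga0 : (g (alpha 1) : A) != 0.
    by apply/eqP => E; move: gv; rewrite E v0 ltNge leey.
  apply: iota_injective; apply: (mulIf ga0).
  by rewrite -!g_alpha rs.
split=> //; set Q := quotmod (range alpha).
have [n0 [e e_gen]] : exists n (e : 'I_n -> Q), forall q, exists c, lincomb e c = q.
  by apply: fg_free_cover; exact: fg_quotmod.
have [n1 [D D_ker]] :=
  submodule_row_fg R_noetherian (submodule_ker (lincomb e)).
pose P := free_resolution R_noetherian e_gen D_ker.
have range_sub := submodule_range alpha.
have [|theta theta_aug] := @row_projective R n0 M Q (quot_pi (range alpha)) (lincomb e).
  by move=> q; exists (repr q); exact: quot_piK.
(* The rows of [D] die in [Q], so [theta] sends them into the image of [alpha]; the preimages are
   the values of [phi] on the standard basis. *)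
have /choice[f fE] : forall j, exists r, alpha r = theta (delta_mx 0 j *m D).
  move=> j; have [r _ rE] : range alpha (theta (delta_mx 0 j *m D)).
    apply/(quot_pi_eq0 _ range_sub); rewrite theta_aug.
    by apply/D_ker; exists (delta_mx 0 j).
  by exists r.
pose phi : {linear 'rV[R]_n1 -> R^o} := lincomb f.
have phi_theta x : alpha (phi x) = theta (x *m D).
  rewrite [in RHS](row_sum_delta x) mulmx_suml !linear_sum.
  by apply: eq_bigr => j _; rewrite -scalemxAl !linearZ fE.
exists P, theta, phi; split=> //.
- move=> x; apply: alpha_inj; rewrite phi_theta linear0.
  have dd0 : res_diff P 0 (res_diff P 1 x) = 0.
    by apply/res_exact; exists x.
  exact: etrans (congr1 theta dd0) (linear0 _).
move=> eps /small[g gv]; exists (g (alpha 1)) => //.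
(* The coboundary of the [i]-th coordinate function on [P 0]. Weighted by the values of [g \o theta]
   on the standard basis, these sum to an element evaluating to [g \o theta \o d], that is, to
   [g \o alpha \o phi], which is [g (alpha 1)] times [phi]. *)
pose coord i : submod (coboundaries (res_diff P 0)) :=
  exist _ (_ : hom (P 1) R^o)
    (asboolT (sub_span (imageT _ (row_coord R i : hom (P 0) R^o)))).
exists (\sum_i tmul iota (g (theta (delta_mx 0 i)) : A^o) (coord i)) => //.
apply: (@tensor_hom_row_inj R A iota n1) => x.
rewrite linearZ tensor_evE mul1r.
rewrite [tensor_map _ _ _ _]linear_sum [LHS]linear_sum.
rewrite [RHS]mulrC -g_alpha phi_theta.
rewrite [in RHS](row_sum_delta (x *m D)) !linear_sum.
apply: eq_bigr => i _.
rewrite tensor_mapE tensor_evE !linearZ [RHS]mulrC; congr (_ * iota _).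
exact: row_coordE.
Qed.

End PhantomCriterion.

(** * Passage from functionals on [M] to their squares on [sym2 M] *)

Theorem mainTheorem2 (K : realType) (R A : idomainType) (m : set R)
    (iota : {rmorphism R -> A}) (v : A -> \bar K)
    (R_noetherian : noetherian R)
    (R_local : local_with m)
    (R_complete : adic_complete m)
    (iota_injective : injective iota)
    (A_local : exists n : set A, local_with n)
    (v_valuation : normalized_valuation v)
    (A_almost_CM : almost_cohen_macaulay iota v m)
    (M : lmodType R) (M_fg : finitely_generated M)
    (alpha : {linear (R^o)%R -> M}) :
  dag_phantom iota v alpha ->
  dag_phantom iota v (scalar_map (sym2_mul (alpha 1%R) (alpha 1%R))).
Proof.
have [vM _ vE _ _] := v_valuation.
have v0 : v 0%R = +oo%E by apply/vE.
move=> /(dag_phantomP alpha R_noetherian iota_injective v0 M_fg) small.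
apply/(dag_phantomP _ R_noetherian iota_injective v0 (fg_sym2 M_fg)) => eps eps0.
(* Squaring doubles the order, hence the bound [eps / 2]. *)
have /small[g gv] : (0 < eps / 2)%R by rewrite divr_gt0.
have [h hE] := sym2_square g.
exists h; rewrite /= /scalar_map scale1r hE vM.
by rewrite [eps]splitr EFinD; exact: lteD.
Qed.
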